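(* Let $\mathscr A$ and $\mathscr B$ be strongly subconvex $L^p$-sets with $p>1$ and $\mathscr A\subseteq\mathscr B$, and put $\mathscr C=\mathscr B\setminus\mathscr A$. If $\mathscr C$ has positive lower density, then $\mathscr C$ is a strongly subconvex $L^p$-set.
   Context: For $\mathscr D\subseteq\mathbb N$ write $\mathscr D(N)=\mathscr D\cap[1,N]$, $D(N)=\mathrm{card}(\mathscr D(N))$, $e(z)=e^{2\pi iz}$ and $I_p(N;\mathscr D)=\int_0^1|\sum_{n\in\mathscr D(N)}e(n\alpha)|^p\,d\alpha$. A non-empty $\mathscr D\subseteq\mathbb N$ is a strongly subconvex $L^p$-set if $0<p<2$ and for all $N$ sufficiently large in terms of $p$, $I_p(N;\mathscr D)\ll N^{-1}D(N)^p$ with implied constant independent of $N$. Positive lower density means $\liminf_{N\to\infty}D(N)/N>0$. *)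

(* Defs.v *)
From mathcomp Require Import all_boot all_order all_algebra.
From mathcomp Require Import finmap complex.
From mathcomp Require Import all_classical all_reals all_analysis.

Set Implicit Arguments.
Unset Strict Implicit.
Unset Printing Implicit Defensive.

Import Order.TTheory GRing.Theory Num.Theory.
Import numFieldNormedType.Exports.

Local Open Scope classical_set_scope.
Local Open Scope ring_scope.

(* Subsets of the natural numbers are of type [set nat]. Only the truncations
   below are ever used, so whether 0 belongs to the set has no influence. *)
Definition truncation (D : set nat) (N : nat) : set nat :=
  D `&` [set n | (1 <= n <= N)%N].

Lemma finite_truncation (D : set nat) (N : nat) : finite_set (truncation D N).
Proof.
apply: (sub_finite_set _ (finite_II N.+1)) => n [_ /andP[_ nN]].
by rewrite /= ltnS.
Qed.

Definition counting_fun (D : set nat) (N : nat) : nat :=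
  #|` fset_set (truncation D N)|.

Section ExponentialSums.
Variable R : realType.

(* e(x) = exp(2 pi i x) for real x, written out by Euler's formula. *)
Definition e2pii (x : R) : R[i] :=
  (cos (2 * pi * x) +i* sin (2 * pi * x))%C.

Definition expsum (D : set nat) (N : nat) (a : R) : R[i] :=
  \sum_(n \in truncation D N) e2pii (n%:R * a).

(* [ComplexField.Normc.normc] is the R-valued modulus on R[i]. *)
Definition mean_value (p : R) (D : set nat) (N : nat) : \bar R :=
  (\int[@lebesgue_measure R]_(a in `[0%R, 1%R])
    (ComplexField.Normc.normc (expsum D N a) `^ p)%:E)%E.

Definition strongly_subconvex (p : R) (D : set nat) : Prop :=
  [/\ D !=set0, 0 < p < 2 &
    exists2 c : R, 0 < c &
      \forall N \near \oo,
        (mean_value p D N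
           <= (c * (N%:R^-1 * (counting_fun D N)%:R `^ p))%:E)%E].

Definition lower_density (D : set nat) : \bar R :=
  limn_einf (fun N : nat => ((counting_fun D N)%:R / N%:R : R)%:E).

End ExponentialSums.

Arguments lower_density : clear implicits.

(* Main.v *)
Require Import Defs.
From mathcomp Require Import all_boot all_order all_algebra.
From mathcomp Require Import finmap complex.
From mathcomp Require Import all_classical all_reals all_analysis.
From mathcomp Require Import measurable_realfun.

(* The exponential sum of B \ A is the difference of those of B and A, so
   |z - w|^p <= 2^p (|z|^p + |w|^p) bounds its p-th moment by a constant times
   N^-1 (A(N)^p + B(N)^p) <= 2 N^-1 N^p; positive lower density of B \ A allows
   N to be replaced by a constant multiple of the counting function of B \ A. *)

Import Order.TTheory GRing.Theory Num.Theory.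
Import numFieldNormedType.Exports.

Local Open Scope classical_set_scope.
Local Open Scope ring_scope.

Import ComplexField.Normc.

Lemma counting_fun_le (D : set nat) (N : nat) : (counting_fun D N <= N)%N.
Proof.
rewrite /counting_fun; set F := fset_set _.
have uF : uniq (enum_fset F) by exact: fset_uniq.
rewrite -[leqRHS](size_iota 1 N); apply: uniq_leq_size => // n.
rewrite mem_iota add1n ltnS => nF.
have : n \in F by [].
by rewrite in_fset_set; [rewrite inE => -[] | exact: finite_truncation].
Qed.

Lemma counting_fun0 (N : nat) : counting_fun set0 N = 0%N.
Proof. by rewrite /counting_fun /truncation set0I fset_set0. Qed.

(** The limit inferior is the supremum of the infima of the tails, so a value strictly below it is
    below the infimum of some tail, hence below every term of that tail. *)
Lemma limn_einf_gt (R : realType) (u : (\bar R)^nat) (a : \bar R) :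
  (a < limn_einf u)%E -> \forall n \near \oo, (a < u n)%E.
Proof.
rewrite limn_einf_lim (cvg_lim _ (@cvg_einfs_sup R u))//.
case/ereal_sup_gt => _ [m _ <-] am; exists m => // n /= mn.
by apply: (lt_le_trans am); apply: ereal_inf_lbound; exists n.
Qed.

Lemma lower_density_gt0 (R : realType) (D : set nat) :
  (0 < lower_density R D)%E ->
  exists2 d : R, 0 < d &
    \forall N \near \oo, d * N%:R <= (counting_fun D N)%:R.
Proof.
move=> D0; have [d /andP[d0 dD]] : exists d : R, (0 < d) && (d%:E < lower_density R D)%E.
  (* The lower density is an extended real: half of a finite value serves as [d], and the formal
     value [+oo] is covered by [d = 1]. *)
  case: (lower_density R D) D0 => [r| |] //.
  - rewrite lte_fin => r0; exists (r / 2).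
    by rewrite divr_gt0//= lte_fin ltr_pdivrMr// ltr_pMr// ltr1n.
  - by move=> _; exists 1; rewrite ltr01 ltry.
exists d => //; have := @limn_einf_gt R _ _ dD; apply: filterS2; last first.
  exact: (nbhs_infty_gt 0).
move=> N N0; rewrite lte_fin ltr_pdivlMr ?ltr0n//; exact: ltW.
Qed.

Lemma expsumD (R : realType) (A B : set nat) (N : nat) (a : R) :
  A `<=` B -> expsum (B `\` A) N a = expsum B N a - expsum A N a.
Proof.
move=> AB; apply/eqP; rewrite eq_sym subr_eq; apply/eqP.
(* The truncations of [B \ A] and [A] are disjoint, and by [A <= B] their union is that of [B]. *)
rewrite /expsum -fsbigU0; [|exact: finite_truncation..|]; last first.
  by move=> n [[[_ nA] _] [/nA]].
by rewrite /truncation -setIUl setUC setDUK.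
Qed.

(** Splitting into real and imaginary parts reduces measurability of the modulus to that of finite
    sums of real cosines and sines. *)
Lemma expsumE (R : realType) (D : set nat) (N : nat) (a : R) :
  expsum D N a =
  ((\sum_(n <- fset_set (truncation D N)) cos (2 * pi * (n%:R * a))) +i*
   \sum_(n <- fset_set (truncation D N)) sin (2 * pi * (n%:R * a)))%C.
Proof.
rewrite /expsum fsbig_finite/=; last exact: finite_truncation.
elim: (enum_fset _) => [|n s IHs]; first by rewrite !big_nil.
by rewrite !big_cons IHs.
Qed.

Lemma measurable_normc_expsum (R : realType) (D : set nat) (N : nat) :
  measurable_fun [set: R] (fun a : R => normc (expsum D N a)).
Proof.
under eq_fun do rewrite expsumE /=.
have ml (n : nat) : measurable_fun [set: R] (fun a : R => 2 * pi * (n%:R * a)).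
  by apply: measurable_funM => //; apply: measurable_funM.
apply: (measurableT_comp (continuous_measurable_fun (@sqrt_continuous R))).
apply: measurable_funD; apply: measurable_funX; apply: measurable_sum => n.
  exact: (measurableT_comp (continuous_measurable_fun (@continuous_cos R))).
exact: (measurableT_comp (continuous_measurable_fun (@continuous_sin R))).
Qed.

(** The triangle inequality gives at most twice the larger modulus, and the [p]-th power of a
    maximum is one of the two powers, hence at most their sum. No convexity enters, so every
    [p >= 0] is allowed. *)
Lemma powR_normcB_le (R : realType) (p : R) (z w : R[i]) : 0 <= p ->
  normc (z - w) `^ p <= 2 `^ p * (normc z `^ p + normc w `^ p).
Proof.
move=> p0; set x := normc z; set y := normc w.
have x0 : 0 <= x by rewrite /x; case: (z) => u v; exact: sqrtr_ge0.
have y0 : 0 <= y by rewrite /y; case: (w) => u v; exact: sqrtr_ge0.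
have xy : normc (z - w) <= 2 * Num.max x y.
  apply: (le_trans (le_normcD z (- w))); rewrite normcN mulr_natl mulr2n.
  by apply: lerD; rewrite le_max lexx ?orbT.
apply: (@le_trans _ _ ((2 * Num.max x y) `^ p)).
  apply: ge0_ler_powR => //; rewrite nnegrE.
    by case: (z - w) => u v; exact: sqrtr_ge0.
  by rewrite mulr_ge0// le_max x0.
rewrite powRM ?le_max ?x0// ler_wpM2l ?powR_ge0//.
by case: (leP x y) => _; rewrite ?lerDl ?lerDr powR_ge0.
Qed.

(** The pointwise bound [powR_normcB_le] is integrated over the unit interval. The integrands are
    nonnegative and measurable, so linearity holds without any finiteness of the moments. *)
Lemma mean_value_setD_le (R : realType) (p : R) (A B : set nat) (N : nat) :
  0 <= p -> A `<=` B ->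
  (mean_value p (B `\` A) N <=
    (2 `^ p)%:E * (mean_value p B N + mean_value p A N))%E.
Proof.
move=> p0 AB.
have mf D : measurable_fun (`[0%R, 1%R] : set R)
    (fun a => (normc (expsum D N a) `^ p)%:E).
  apply/measurable_EFinP; apply: measurable_funTS.
  exact: (measurableT_comp (measurable_powR p) (measurable_normc_expsum _ _ _)).
have f0 D (a : R) : (0 <= (normc (expsum D N a) `^ p)%:E)%E.
  by rewrite lee_fin powR_ge0.
rewrite /mean_value -ge0_integralD//; [|exact: mf..].
rewrite -ge0_integralZl_EFin ?powR_ge0//; last 2 first.
- by move=> a _; rewrite adde_ge0 ?f0.
- exact: (emeasurable_funD (mf B) (mf A)).
apply: ge0_le_integral => //; first exact: mf.
  exact: (measurable_funeM _ (emeasurable_funD (mf B) (mf A))).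
by move=> a _; rewrite -EFinD -EFinM lee_fin expsumD// powR_normcB_le.
Qed.

Theorem theorem3p1 (R : realType) (p : R) (A B : set nat) :
  1 < p ->
  strongly_subconvex p A ->
  strongly_subconvex p B ->
  A `<=` B ->
  (0 < lower_density R (B `\` A))%E ->
  strongly_subconvex p (B `\` A).
Proof.
move=> _ [_ p02 [cA cA0 hA]] [_ _ [cB cB0 hB]] AB.
move=> /lower_density_gt0[d d0 hd].
have p0 : 0 <= p by move/andP: p02 => [/ltW].
split => //.
  (* An empty difference would have counting function 0, against the lower bound [d * N > 0] for
     large [N]. *)
  apply/set0P/negP => /eqP C0; rewrite C0 in hd.
  near \oo => N.
  have : d * N%:R <= (counting_fun set0 N)%:R by near: N; exact: hd.
  rewrite counting_fun0 leNgt mulr_gt0 ?ltr0n//.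
  by near: N; exact: (nbhs_infty_gt 0).
(* The factor [2 ^ p] comes from splitting the exponential sum, [cB + cA] from the two moment
   bounds, and the power of [d^-1] from replacing [N] by [d^-1] times the counting function of
   [B \ A]. *)
exists (2 `^ p * (cB + cA) * d^-1 `^ p).
  by rewrite !mulr_gt0 ?addr_gt0 ?powR_gt0 ?invr_gt0.
near=> N.
have hAN : (mean_value p A N <= (cA * (N%:R^-1 * N%:R `^ p))%:E)%E.
  apply: (@le_trans _ _ (cA * (N%:R^-1 * (counting_fun A N)%:R `^ p))%:E).
    by near: N.
  rewrite lee_fin !ler_wpM2l ?invr_ge0// ?(ltW cA0)//.
  by rewrite ge0_ler_powR ?nnegrE// ler_nat counting_fun_le.
have hBN : (mean_value p B N <= (cB * (N%:R^-1 * N%:R `^ p))%:E)%E.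
  apply: (@le_trans _ _ (cB * (N%:R^-1 * (counting_fun B N)%:R `^ p))%:E).
    by near: N.
  rewrite lee_fin !ler_wpM2l ?invr_ge0// ?(ltW cB0)//.
  by rewrite ge0_ler_powR ?nnegrE// ler_nat counting_fun_le.
apply: (le_trans (mean_value_setD_le _ _ _ _ _ p0 AB)).
apply: (le_trans (lee_wpmul2l _ (leeD hBN hAN))); first by rewrite lee_fin powR_ge0.
rewrite -EFinD -EFinM lee_fin -mulrDl -!mulrA !ler_wpM2l ?powR_ge0//.
  by rewrite addr_ge0 ?ltW.
(* With the common factor [N^-1] cancelled, monotonicity of the [p]-th power leaves the density
   bound [hd] in the form [N <= d^-1 * C(N)], where [C] is [B \ A]. *)
rewrite mulrCA ler_wpM2l ?invr_ge0//.
rewrite -powRM ?invr_ge0 ?(ltW d0)// ge0_ler_powR ?nnegrE ?mulr_ge0 ?invr_ge0 ?(ltW d0)//.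
by rewrite ler_pdivlMl//; near: N.
Unshelve. all: by end_near. Qed.
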